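(* Let $(V,Q)$ be an $L_\infty[1]$ algebra with linear Taylor coefficient $q_1$. If the evaluation morphism $$e:(\mathrm{Coder}(SV),[Q,\cdot])\to(V,q_1):\ R\mapsto R(1)=r_0(1)$$ admits a dg right inverse, then the $L_\infty[1]$ algebra $(V,Q)$ is homotopy abelian.
   Context: We work over a field $\mathbb{K}$ of characteristic zero; graded means $\mathbb{Z}$-graded. $SV=\bigoplus_{n\ge0}V^{\odot n}$ and $\overline{S}V=\bigoplus_{n\ge1}V^{\odot n}$ are the symmetric and reduced symmetric coalgebras over $V$, $V^{\odot0}=\mathbb{K}$. Corestriction gives isomorphisms $\mathrm{Coder}(SV)\cong\prod_{i\ge0}\mathrm{Hom}(V^{\odot i},V)$ and $\mathrm{Coder}(\overline{S}V)\cong\prod_{i\ge1}\mathrm{Hom}(V^{\odot i},V)$; the components $r_i$ of a coderivation $R$ are its Taylor coefficients. $\mathrm{Coder}(\overline{S}V)$ is identified with the graded Lie subalgebra of $\mathrm{Coder}(SV)$ of coderivations with vanishing $0$-th coefficient; the bracket is the graded commutator. An $L_\infty[1]$ algebra $(V,Q)$ is a graded space $V$ with a degree one coderivation $Q\in\mathrm{Coder}(\overline{S}V)$ such that $Q^2=0$; thus $[Q,\cdot]$ is a differential on $\mathrm{Coder}(SV)$ and $e$ is a morphism of dg spaces (complexes). A dg right inverse of $e$ is a morphism of dg spaces $\sigma:(V,q_1)\to(\mathrm{Coder}(SV),[Q,\cdot])$ with $e\sigma=\mathrm{id}_V$. $L_\infty[1]$ morphisms are morphisms of dg coalgebras between the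 reduced symmetric coalgebras; a weak equivalence is one whose linear part is a quasi-isomorphism of complexes $(V,q_1)$. $(V,Q)$ is abelian if $q_i=0$ for $i\ge2$, and homotopy abelian if it is weakly equivalent to an abelian one. *)

(* Defs.v *)
From HB Require Import structures.
From Stdlib Require Import Relations.
From mathcomp Require Import all_boot all_order all_algebra.
From mathcomp.classical Require Import boolp.
From mathcomp.multinomials Require Import freeg.

Set Implicit Arguments.
Unset Strict Implicit.
Unset Printing Implicit Defensive.

Import GRing.Theory.
Import Quotient.

Local Open Scope ring_scope.
Local Open Scope quotient_scope.

Section Span.
Variables (K : fieldType) (M : lmodType K) (rel : M -> Prop).

Inductive span : M -> Prop :=
| span0 : span 0
| spanD a r x : rel r -> span x -> span (a *: r + x).

Lemma span_add x y : span x -> span y -> span (x + y).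
Proof.
by elim=> [|a r z rr _ IH] sy; [rewrite add0r | rewrite -addrA; apply/spanD/IH].
Qed.

Lemma span_scale a x : span x -> span (a *: x).
Proof.
elim=> [|b r z rr _ IH]; first by rewrite scaler0; apply: span0.
by rewrite scalerDr scalerA; apply: spanD.
Qed.

Definition span_pred : {pred M} := fun x => `[< span x >].

Lemma span_predP x : reflect (span x) (x \in span_pred).
Proof. exact: asboolP. Qed.

Lemma span_zmod_closed : zmod_closed span_pred.
Proof.
split=> [|x y /span_predP sx /span_predP sy]; first exact/span_predP/span0.
by apply/span_predP; rewrite -scaleN1r; apply/span_add/span_scale.
Qed.

HB.instance Definition _ := GRing.isZmodClosed.Build M span_pred span_zmod_closed.

Definition quotient_space := {quot span_pred}.

HB.instance Definition _ := GRing.Zmodule.on quotient_space.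

Definition quotient_class (x : M) : quotient_space := \pi_(quotient_space) x.

Lemma quotient_class_eq x y :
  quotient_class x = quotient_class y <-> span (x - y).
Proof.
split=> [/eqP|/span_predP]; rewrite /quotient_class.
  by rewrite -idealrBE => /span_predP.
by rewrite idealrBE => /eqP.
Qed.

Lemma quotient_classD : {morph quotient_class : x y / x + y}.
Proof. by move=> x y; rewrite /quotient_class !piE. Qed.

Definition quotient_scale (a : K) (q : quotient_space) : quotient_space :=
  quotient_class (a *: repr q).

Lemma quotient_scale_class a x :
  quotient_scale a (quotient_class x) = quotient_class (a *: x).
Proof.
apply/quotient_class_eq; rewrite -scalerBr; apply: span_scale.
by apply/quotient_class_eq; rewrite /quotient_class reprK.
Qed.

Lemma quotient_classW (P : quotient_space -> Prop) :
  (forall x, P (quotient_class x)) -> forall q, P q.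
Proof. by move=> H q; rewrite -[q]reprK; apply: H. Qed.

Fact quotient_scaleA a b q :
  quotient_scale a (quotient_scale b q) = quotient_scale (a * b) q.
Proof.
by elim/quotient_classW: q => x; rewrite !quotient_scale_class scalerA.
Qed.

Fact quotient_scale1 : left_id 1 quotient_scale.
Proof. by elim/quotient_classW => x; rewrite quotient_scale_class scale1r. Qed.

Fact quotient_scaleDr : right_distributive quotient_scale +%R.
Proof.
move=> a; elim/quotient_classW => x; elim/quotient_classW => y.
by rewrite -quotient_classD !quotient_scale_class -quotient_classD scalerDr.
Qed.

Fact quotient_scaleDl q : {morph quotient_scale^~ q : a b / a + b}.
Proof.
move=> a b; elim/quotient_classW: q => x.
by rewrite !quotient_scale_class -quotient_classD scalerDl.
Qed.

HB.instance Definition _ := GRing.Zmodule_isLmodule.Build K quotient_space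
  quotient_scaleA quotient_scale1 quotient_scaleDr quotient_scaleDl.

Lemma quotient_class_is_linear : linear quotient_class.
Proof.
by move=> a x y; rewrite quotient_classD -quotient_scale_class.
Qed.

HB.instance Definition _ :=
  GRing.isLinear.Build K M quotient_space _ quotient_class
    quotient_class_is_linear.

End Span.

Section Presented.
Variables (K : fieldType) (T : choiceType) (rel : {freeg T / K} -> Prop).

Definition presented := quotient_space rel.

HB.instance Definition _ := GRing.Lmodule.on presented.

Definition presented_gen (t : T) : presented := quotient_class rel << t >>.

Section Lift.
Variables (M : lmodType K) (f : T -> M).

Lemma fgliftB x y : fglift f (x - y) = fglift f x - fglift f y.
Proof. exact: lift_is_additive. Qed.

Lemma fglift0 : fglift f 0 = 0.
Proof. by have := fgliftB 0 0; rewrite !subrr. Qed.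

Lemma fglift_is_linear : linear (fglift f).
Proof.
have addf : {morph fglift f : x y / x + y}.
  move=> x y; have := fgliftB x (- y); rewrite opprK => ->.
  by have := fgliftB 0 y; rewrite sub0r fglift0 sub0r => ->; rewrite opprK.
move=> a x y; rewrite addf; congr (_ + _).
rewrite -{2}[x]freeg_sumE -{1}[x]freeg_sumE !scaler_sumr.
elim: (dom x) => [|t s IH]; first by rewrite !big_nil fglift0 scaler0.
rewrite !big_cons !addf scalerDr IH; congr (_ + _).
have -> : a *: << coeff t x *g t >> = << a * coeff t x *g t >> :> {freeg T / K}.
  by apply/eqP/freeg_eqP => z; rewrite coeffZ !coeffU mulrA.
by rewrite !liftU scalerA.
Qed.

Hypothesis f_rel : forall r, rel r -> fglift f r = 0.

Definition presented_lift (_ : forall r, rel r -> fglift f r = 0)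
  (q : presented) : M := fglift f (repr q).

Lemma presented_lift_class x :
  presented_lift f_rel (quotient_class rel x) = fglift f x.
Proof.
have /quotient_class_eq : quotient_class rel (repr (quotient_class rel x))
    = quotient_class rel x by rewrite /quotient_class reprK.
rewrite /presented_lift; set y := repr _ => sp.
apply/eqP; rewrite -subr_eq0 -fgliftB.
elim: sp => [|a r z /f_rel rr _ IH]; first by rewrite fglift0.
by rewrite fglift_is_linear rr scaler0 add0r.
Qed.

Lemma presented_lift_is_linear : linear (presented_lift f_rel).
Proof.
move=> a; elim/quotient_classW => x; elim/quotient_classW => y.
by rewrite -quotient_class_is_linear !presented_lift_class fglift_is_linear.
Qed.

HB.instance Definition _ :=
  GRing.isLinear.Build K presented M _ (presented_lift f_rel)
    presented_lift_is_linear.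

Lemma presented_lift_gen t : presented_lift f_rel (presented_gen t) = f t.
Proof. by rewrite presented_lift_class liftU scale1r. Qed.

End Lift.

Lemma presented_genW (P : presented -> Prop) :
  P 0 -> (forall a t x, P x -> P (a *: presented_gen t + x)) ->
  forall q, P q.
Proof.
move=> P0 PD; elim/quotient_classW => x; rewrite -[x]freeg_sumE.
elim: (dom x) => [|t s IH].
  rewrite big_nil; suff -> : quotient_class rel 0 = 0 by [].
  exact: (raddf0 (quotient_class rel)).
rewrite big_cons.
have -> : << coeff t x *g t >> = coeff t x *: << t >> :> {freeg T / K}.
  by apply/eqP/freeg_eqP => z; rewrite coeffZ !coeffU mul1r.
by rewrite quotient_class_is_linear; apply: PD.
Qed.

End Presented.

Section Tensor.
Variables (K : fieldType) (A B : lmodType K).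

Inductive tensor_rel : {freeg (A * B)%type / K} -> Prop :=
| tensor_linl a x y z :
    tensor_rel (<< (a *: x + y, z) >> - (a *: << (x, z) >> + << (y, z) >>))
| tensor_linr a x y z :
    tensor_rel (<< (z, a *: x + y) >> - (a *: << (z, x) >> + << (z, y) >>)).

Definition tensor := presented tensor_rel.

HB.instance Definition _ := GRing.Lmodule.on tensor.

Definition tens (x : A) (y : B) : tensor := presented_gen tensor_rel (x, y).

Lemma tens_linl z : linear (tens^~ z).
Proof.
move=> a x y; rewrite /tens /presented_gen -quotient_class_is_linear.
apply/quotient_class_eq; rewrite -[X in span _ X]scale1r -[X in span _ X]addr0.
by apply: spanD; [apply: tensor_linl | apply: span0].
Qed.

Lemma tens_linr z : linear (tens z).
Proof.
move=> a x y; rewrite /tens /presented_gen -quotient_class_is_linear.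
apply/quotient_class_eq; rewrite -[X in span _ X]scale1r -[X in span _ X]addr0.
by apply: spanD; [apply: tensor_linr | apply: span0].
Qed.

Lemma tensZl a x z : tens (a *: x) z = a *: tens x z.
Proof.
have t0 : tens 0 z = 0.
  by apply: (addIr (tens 0 z)); rewrite -[X in X + _]scale1r -tens_linl scale1r !add0r.
by rewrite -[a *: x]addr0 tens_linl t0 addr0.
Qed.

Lemma tensZr a x z : tens z (a *: x) = a *: tens z x.
Proof.
have t0 : tens z 0 = 0.
  by apply: (addIr (tens z 0)); rewrite -[X in X + _]scale1r -tens_linr scale1r !add0r.
by rewrite -[a *: x]addr0 tens_linr t0 addr0.
Qed.

End Tensor.

Section TensorLift.
Variables (K : fieldType) (A B M : lmodType K) (f : A -> B -> M).
Hypothesis f_bilin : (forall z, linear (f^~ z)) /\ (forall z, linear (f z)).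

Lemma tensor_lift_rel r :
  tensor_rel r -> fglift (fun p : A * B => f p.1 p.2) r = 0.
Proof.
case: f_bilin => fl fr.
by case=> a x y z; rewrite fgliftB fglift_is_linear !liftU !scale1r /=
  ?fl ?fr subrr.
Qed.

Definition tensor_lift : {linear tensor A B -> M} :=
  presented_lift tensor_lift_rel.

Lemma tensor_liftE x y : tensor_lift (tens x y) = f x y.
Proof. exact: presented_lift_gen. Qed.

End TensorLift.

Section TensorMap.
Variables (K : fieldType) (A B A' B' : lmodType K).
Variables (f : {linear A -> A'}) (g : {linear B -> B'}).

Lemma tensor_map_bilin :
  (forall z, linear ((fun x y => tens (f x) (g y))^~ z)) /\
  (forall z, linear ((fun x y => tens (f x) (g y)) z)).
Proof.
by split=> z a x y /=; rewrite linearP (tens_linl, tens_linr).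
Qed.

(** No Koszul sign is built in: signs are supplied by [koszul] below. *)
Definition tensor_map : {linear tensor A B -> tensor A' B'} :=
  tensor_lift tensor_map_bilin.

Lemma tensor_mapE x y : tensor_map (tens x y) = tens (f x) (g y).
Proof. exact: tensor_liftE. Qed.

End TensorMap.

Section Words.
Variables (K : fieldType) (V : int -> lmodType K).

(** A graded space is given by its homogeneous components; a letter is a
    homogeneous element together with its degree. *)
Definition letter : Type := {i : int & V i}.

HB.instance Definition _ := Choice.on letter.

Definition wdeg (w : seq letter) : int := \sum_(x <- w) tag x.

Lemma sgnD (m n : int) : (-1) ^ (m + n) = (-1) ^ m * (-1) ^ n :> K.
Proof. by rewrite expfzDr // oppr_eq0 oner_eq0. Qed.

Lemma sgnK (n : int) : (-1) ^ n * (-1) ^ n = 1 :> K.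
Proof. by rewrite -expfzMl mulrNN mulr1 exp1rz. Qed.

Record symmetric_multilinear (M : lmodType K) (f : seq letter -> M) : Prop := {
  smul_lin : forall u w i a (x y : V i),
    f (u ++ Tagged V (a *: x + y) :: w) =
    a *: f (u ++ Tagged V x :: w) + f (u ++ Tagged V y :: w);
  smul_sym : forall u w (x y : letter),
    f (u ++ x :: y :: w) = (-1) ^ (tag x * tag y) *: f (u ++ y :: x :: w) }.

(** The unshuffles [(A, A^c)] of a word, with their Koszul signs. *)
Fixpoint unshuffles (w : seq letter) : seq (K * (seq letter * seq letter)) :=
  if w is x :: w' then
    [seq (t.1, (x :: t.2.1, t.2.2)) | t <- unshuffles w'] ++
    [seq ((-1) ^ (tag x * wdeg t.2.1) * t.1, (t.2.1, x :: t.2.2))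
    | t <- unshuffles w']
  else [:: (1, ([::], [::]))].

Lemma wdeg_cons x w : wdeg (x :: w) = tag x + wdeg w.
Proof. exact: big_cons. Qed.

Lemma wdeg_cat u w : wdeg (u ++ w) = wdeg u + wdeg w.
Proof. exact: big_cat. Qed.

Definition unshuffle_sum (M : lmodType K) (b : seq letter -> seq letter -> M) w :=
  \sum_(t <- unshuffles w) t.1 *: b t.2.1 t.2.2.

Lemma unshuffle_sum_cons (M : lmodType K) b x w :
  unshuffle_sum b (x :: w) = unshuffle_sum (fun u v => b (x :: u) v) w +
    unshuffle_sum (fun u v => (-1) ^ (tag x * wdeg u) *: b u (x :: v)) w :> M.
Proof.
rewrite /unshuffle_sum /= big_cat !big_map /=; congr (_ + _).
by apply: eq_bigr => t _; rewrite scalerA mulrC.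
Qed.

Lemma eq_unshuffle_sum (M : lmodType K) (b c : seq letter -> seq letter -> M) w :
  (forall u v, b u v = c u v) -> unshuffle_sum b w = unshuffle_sum c w.
Proof. by move=> E; apply: eq_bigr => t _; rewrite E. Qed.

Lemma unshuffle_sumP (M : lmodType K) a (b c : seq letter -> seq letter -> M) w :
  unshuffle_sum (fun u v => a *: b u v + c u v) w =
  a *: unshuffle_sum b w + unshuffle_sum c w.
Proof.
rewrite /unshuffle_sum scaler_sumr -big_split; apply: eq_bigr => t _.
by rewrite scalerDr !scalerA mulrC.
Qed.

Lemma unshuffle_sum_smul (M : lmodType K) (b : seq letter -> seq letter -> M) :
  (forall v, symmetric_multilinear (b^~ v)) ->
  (forall u, symmetric_multilinear (b u)) ->
  symmetric_multilinear (unshuffle_sum b).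
Proof.
move=> bl br.
have stepl (b' : seq letter -> seq letter -> M) x :
  (forall v, symmetric_multilinear (b'^~ v)) ->
  forall v, symmetric_multilinear ((fun u v => b' (x :: u) v)^~ v).
  move=> H v; split=> [u w i a y z|u w y z].
    exact: (smul_lin (H v) (x :: u)).
  exact: (smul_sym (H v) (x :: u)).
have stepr (b' : seq letter -> seq letter -> M) x :
  (forall v, symmetric_multilinear (b'^~ v)) ->
  forall v, symmetric_multilinear
    ((fun u v => (-1) ^ (tag x * wdeg u) *: b' u (x :: v))^~ v).
  move=> H v; split=> [u w i a y z|u w y z].
    rewrite (smul_lin (H (x :: v))) scalerDr !scalerA !wdeg_cat !wdeg_cons /=.
    by rewrite [_ * a]mulrC.
  rewrite (smul_sym (H (x :: v))) !scalerA !wdeg_cat !wdeg_cons.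
  by rewrite (addrCA (tag y)) mulrC.
have stepl' (b' : seq letter -> seq letter -> M) x :
  (forall u, symmetric_multilinear (b' u)) ->
  forall u, symmetric_multilinear (b' (x :: u)) by move=> H u; apply: H.
have stepr' (b' : seq letter -> seq letter -> M) x :
  (forall u, symmetric_multilinear (b' u)) ->
  forall u, symmetric_multilinear
    (fun v => (-1) ^ (tag x * wdeg u) *: b' u (x :: v)).
  move=> H v; split=> [u w i a y z|u w y z].
    by rewrite (smul_lin (H v) (x :: u)) scalerDr !scalerA [_ * a]mulrC.
  by rewrite (smul_sym (H v) (x :: u)) !scalerA mulrC.
split=> [u w i a x y|u w x y]; elim: u b bl br => [|z u IH] b bl br.
- rewrite !unshuffle_sum_cons scalerDr addrACA -!unshuffle_sumP.
  congr (_ + _); apply: eq_unshuffle_sum => u v.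
    exact: (smul_lin (bl v) [::]).
  by rewrite (smul_lin (br u) [::]) scalerDr !scalerA [_ * a]mulrC.
- rewrite !cat_cons !unshuffle_sum_cons scalerDr addrACA.
  by congr (_ + _); apply: IH; [apply: stepl|apply: stepl'|apply: stepr|apply: stepr'].
- have swap4 c (p q r s p' q' r' s' : M) : p = c *: p' -> q = c *: r' ->
      r = c *: q' -> s = c *: s' -> p + q + (r + s) = c *: (p' + q' + (r' + s')).
    by move=> -> -> -> ->; rewrite !scalerDr addrACA.
  have scaleE c (b1 b2 : seq letter -> seq letter -> M) :
      (forall u v, b1 u v = c *: b2 u v) ->
      unshuffle_sum b1 w = c *: unshuffle_sum b2 w.
    move=> E; rewrite /unshuffle_sum scaler_sumr; apply: eq_bigr => t _.
    by rewrite E !scalerA mulrC.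
  rewrite /= !unshuffle_sum_cons; apply: swap4; apply: scaleE => u v.
  + exact: (smul_sym (bl v) [::]).
  + by rewrite scalerA wdeg_cons mulrDr sgnD mulrA [tag y * tag x]mulrC sgnK mul1r.
  + by rewrite scalerA wdeg_cons mulrDr sgnD.
  + rewrite (smul_sym (br u) [::]) !scalerA.
    by rewrite /= mulrC [_ * (-1) ^ (tag x * wdeg u)]mulrC.
- rewrite !cat_cons !unshuffle_sum_cons scalerDr.
  by congr (_ + _); apply: IH; [apply: stepl|apply: stepl'|apply: stepr|apply: stepr'].
Qed.

End Words.

Section Sym.
Variables (K : fieldType) (V : int -> lmodType K) (m : nat).

Definition word : Type := {w : seq (letter V) | m <= size w}%N.

HB.instance Definition _ := Choice.on word.

Inductive sym_rel : {freeg word / K} -> Prop :=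
| sym_rel_lin u w i a (x y : V i) (w0 w1 w2 : word) :
    val w0 = u ++ Tagged V (a *: x + y) :: w ->
    val w1 = u ++ Tagged V x :: w ->
    val w2 = u ++ Tagged V y :: w ->
    sym_rel (<< w0 >> - (a *: << w1 >> + << w2 >>))
| sym_rel_sym u w (x y : letter V) (w1 w2 : word) :
    val w1 = u ++ x :: y :: w ->
    val w2 = u ++ y :: x :: w ->
    sym_rel (<< w1 >> - (-1) ^ (tag x * tag y) *: << w2 >>).

(** The direct sum of the symmetric powers of [V] of order at least [m]:
    the symmetric coalgebra for [m = 0] and the reduced one for [m = 1]. *)
Definition sym := presented sym_rel.

HB.instance Definition _ := GRing.Lmodule.on sym.

(** The monomial of a word; it is [0] for a word shorter than [m]. *)
Definition mono (w : seq (letter V)) : sym :=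
  if insub w is Some w' then presented_gen sym_rel w' else 0.

Lemma mono_short w : (size w < m)%N -> mono w = 0.
Proof. by move=> lt_wm; rewrite /mono insubF // leqNgt lt_wm. Qed.

Lemma mono_long w (le_mw : (m <= size w)%N) :
  mono w = presented_gen sym_rel (Sub w le_mw).
Proof. by rewrite /mono insubT. Qed.

Lemma mono_smul : symmetric_multilinear mono.
Proof.
split=> [u w i a x y|u w x y].
  have [le_m|lt_m] := leqP m (size u + (size w).+1); last first.
    by rewrite !mono_short ?size_cat //= scaler0 addr0.
  have szE z : (m <= size (u ++ Tagged V z :: w))%N by rewrite size_cat.
  rewrite !mono_long /presented_gen -quotient_class_is_linear.
  apply/quotient_class_eq; rewrite -[X in span _ X]scale1r -[X in span _ X]addr0.
  by apply: spanD; [apply: sym_rel_lin; apply: SubK | apply: span0].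
have [le_m|lt_m] := leqP m (size u + (size w).+2); last first.
  by rewrite !mono_short ?size_cat //= scaler0.
have szE s t : (m <= size (u ++ s :: t :: w))%N by rewrite size_cat.
rewrite !mono_long /presented_gen -linearZ.
apply/quotient_class_eq; rewrite -[X in span _ X]scale1r -[X in span _ X]addr0.
by apply: spanD; [apply: sym_rel_sym; apply: SubK | apply: span0].
Qed.

Section Lift.
Variables (M : lmodType K) (f : seq (letter V) -> M).
Hypothesis f_smul : symmetric_multilinear f.

Lemma sym_lift_rel r : sym_rel r -> fglift (fun w : word => f (val w)) r = 0.
Proof.
case=> [u w i a x y w0 w1 w2 E0 E1 E2|u w x y w1 w2 E1 E2].
  rewrite fgliftB fglift_is_linear !liftU !scale1r E0 E1 E2.
  by rewrite (smul_lin f_smul) subrr.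
rewrite fgliftB -[_ *: << w2 >>]addr0 fglift_is_linear fglift0 !liftU.
by rewrite !scale1r E1 E2 (smul_sym f_smul) addr0 subrr.
Qed.

Definition sym_lift : {linear sym -> M} := presented_lift sym_lift_rel.

Lemma sym_liftE w : (m <= size w)%N -> sym_lift (mono w) = f w.
Proof. by move=> le_mw; rewrite mono_long; apply: presented_lift_gen. Qed.

End Lift.

Lemma symW (P : sym -> Prop) :
  P 0 -> (forall a w x, (m <= size w)%N -> P x -> P (a *: mono w + x)) ->
  forall x, P x.
Proof.
move=> P0 PD; apply: presented_genW => // a [w le_mw] x Px.
by rewrite -mono_long; apply: PD.
Qed.

Definition sym_homogeneous (d : int) (x : sym) : Prop :=
  span (fun y => exists2 w, wdeg w = d & y = mono w) x.

End Sym.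

Section SymMaps.
Variables (K : fieldType) (V : int -> lmodType K).

Section Comult.
Variable m : nat.

Lemma comult_smul : symmetric_multilinear
  (unshuffle_sum (fun u v => tens (mono m u) (mono m v) : tensor (sym V m) (sym V m))).
Proof.
apply: unshuffle_sum_smul => u; split=> [u' w i a x y|u' w x y].
- by rewrite (smul_lin (mono_smul _ _)) tens_linl.
- rewrite (smul_sym (mono_smul _ _)).
  exact: tensZl.
- by rewrite (smul_lin (mono_smul _ _)) tens_linr.
- rewrite (smul_sym (mono_smul _ _)).
  exact: tensZr.
Qed.

(** The unshuffle coproduct.  Since [mono 1 [::] = 0], for [m = 1] only the
    unshuffles into two nonempty words contribute. *)
Definition comult : {linear sym V m -> tensor (sym V m) (sym V m)} :=
  sym_lift m comult_smul.

Lemma comultE w : (m <= size w)%N -> comult (mono m w) =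
  \sum_(t <- unshuffles w) t.1 *: tens (mono m t.2.1) (mono m t.2.2).
Proof. exact: sym_liftE. Qed.

Lemma koszul_smul d : symmetric_multilinear
  (fun w => (-1) ^ (d * wdeg w) *: mono m w : sym V m).
Proof.
split=> [u w i a x y|u w x y].
  rewrite (smul_lin (mono_smul _ _)) scalerDr !scalerA !wdeg_cat !wdeg_cons /=.
  by rewrite [_ * a]mulrC.
rewrite (smul_sym (mono_smul _ _)) !scalerA !wdeg_cat !wdeg_cons.
by rewrite (addrCA (tag y)) mulrC.
Qed.

(** The sign in [(id ⊗ R)(x ⊗ y) = (-1)^(d |x|) x ⊗ R y], [R] of degree [d]. *)
Definition koszul (d : int) : {linear sym V m -> sym V m} :=
  sym_lift m (koszul_smul d).

Lemma koszulE d w : (m <= size w)%N ->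
  koszul d (mono m w) = (-1) ^ (d * wdeg w) *: mono m w.
Proof. exact: sym_liftE. Qed.

Definition single (j : int) (w : seq (letter V)) : V j :=
  if w is [:: x] then untag (T_ := V) (0 : V j) (i := j) id x else 0.

Lemma single_smul j : symmetric_multilinear (single j).
Proof.
split=> [[|z [|z' u]] [|z'' w] i a x y|[|z [|z' u]] w x y] /=;
  rewrite ?scaler0 ?addr0 //.
have [ij|ne_ij] := eqVneq i j; last by rewrite !untag_dflt //= scaler0 addr0.
by case: j / ij; rewrite !untagE ?etaggedE.
Qed.

(** The projection onto [V], one degree [j] at a time. *)
Definition proj (j : int) : {linear sym V m -> V j} :=
  sym_lift m (single_smul j).

Lemma projE j w : (m <= size w)%N -> proj j (mono m w) = single j w.
Proof. exact: sym_liftE. Qed.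

End Comult.

(** For [m <= m'] the projection killing the words shorter than [m'],
    for [m' <= m] the inclusion. *)
Definition resize (m m' : nat) : {linear sym V m -> sym V m'} :=
  sym_lift m (mono_smul V m').

Lemma resizeE m m' w : (m <= size w)%N -> resize m m' (mono m w) = mono m' w.
Proof. exact: sym_liftE. Qed.

End SymMaps.

Section Coderivations.
Variables (K : fieldType).

Definition has_degree (V W : int -> lmodType K) m d
    (F : {linear sym V m -> sym W m}) : Prop :=
  forall k x, sym_homogeneous k x -> sym_homogeneous (k + d) (F x).

Variables (V : int -> lmodType K).

Definition coderivation m d (R : {linear sym V m -> sym V m}) : Prop :=
  has_degree d R /\
  forall x, comult V m (R x) =
    tensor_map R idfun (comult V m x) + tensor_map (koszul V m d) R (comult V m x).

(** The component in degree [j] of the Taylor coefficients: [taylor R j w] is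
    that of [r_n (x_1 ⊙ ... ⊙ x_n)] for the word [w = x_1 ... x_n]. *)
Definition taylor (W : int -> lmodType K) m (F : sym V m -> sym W m) (j : int)
  (w : seq (letter V)) : W j := proj W m j (F (mono m w)).

(** The graded commutator of [A] of degree [d] and [B] of degree [e]. *)
Definition commutator m d e (A B : sym V m -> sym V m) (x : sym V m) : sym V m :=
  A (B x) - (-1) ^ (d * e) *: B (A x).

(** The inclusion of the coderivations of the reduced symmetric coalgebra into
    those of the symmetric one, as those with [r_0 = 0]. *)
Definition extend_coder (Q : {linear sym V 1 -> sym V 1}) :
    {linear sym V 0 -> sym V 0} :=
  resize V 1 0 \o Q \o resize V 0 1.

(** The component of degree [j] of [R(1) = r_0(1)]. *)
Definition evaluation (R : sym V 0 -> sym V 0) (j : int) : V j :=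
  taylor R j [::].

End Coderivations.

Record Linfty (K : fieldType) := {
  Lspace : int -> lmodType K;
  LQ : {linear sym Lspace 1 -> sym Lspace 1};
  LQ_coder : coderivation 1 LQ;
  LQ_square : forall x, LQ (LQ x) = 0 }.

Section Linfty.
Variable K : fieldType.
Implicit Types L M : Linfty K.

(** The linear coefficient [q_1], with values in degree [j]; it vanishes
    unless [j = i + 1]. *)
Definition q1 L i j (v : Lspace L i) : Lspace L j :=
  taylor (LQ L) j [:: Tagged (Lspace L) v].

Definition cocycle L i (v : Lspace L i) : Prop := q1 (i + 1) v = 0.

Definition coboundary L i (v : Lspace L i) : Prop :=
  exists u : Lspace L (i - 1), v = q1 i u.

Record Linfty_morphism L M
    (F : {linear sym (Lspace L) 1 -> sym (Lspace M) 1}) : Prop := {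
  mor_degree : has_degree 0 F;
  mor_comult : forall x,
    comult (Lspace M) 1 (F x) = tensor_map F F (comult (Lspace L) 1 x);
  mor_Q : forall x, F (LQ L x) = LQ M (F x) }.

Definition linear_part L M (F : {linear sym (Lspace L) 1 -> sym (Lspace M) 1}) i
  (v : Lspace L i) : Lspace M i := taylor F i [:: Tagged (Lspace L) v].

(** [f] induces an injective and a surjective map in cohomology. *)
Definition quasi_isomorphism L M (f : forall i, Lspace L i -> Lspace M i) : Prop :=
  forall i,
    (forall v, cocycle v -> coboundary (f i v) -> coboundary v) /\
    (forall w, cocycle w -> exists2 v, cocycle v & coboundary (w - f i v)).

Definition weak_equivalence L M
    (F : {linear sym (Lspace L) 1 -> sym (Lspace M) 1}) : Prop :=
  Linfty_morphism F /\ quasi_isomorphism (linear_part F).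

(** The equivalence relation generated by weak equivalences. *)
Definition weakly_equivalent : relation (Linfty K) :=
  clos_refl_sym_trans (Linfty K)
    (fun L M => exists F, @weak_equivalence L M F).

Definition abelian_Linfty L : Prop :=
  forall w j, (2 <= size w)%N -> taylor (LQ L) j w = 0.

Definition homotopy_abelian L : Prop :=
  exists2 A, abelian_Linfty A & weakly_equivalent L A.

(** [s] is a morphism of complexes [(V, q_1) -> (Coder(SV), [Q, -])] with
    [e s = id]; homogeneous elements go to homogeneous coderivations. *)
Record dg_right_inverse L
    (s : forall i, Lspace L i -> {linear sym (Lspace L) 0 -> sym (Lspace L) 0}) :
    Prop := {
  rinv_linear : forall i a (u v : Lspace L i) x,
    s i (a *: u + v) x = a *: s i u x + s i v x;
  rinv_coder : forall i (v : Lspace L i), coderivation i (s i v);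
  rinv_dg : forall i (v : Lspace L i) x,
    s (i + 1) (q1 (i + 1) v) x =
    commutator 1 i (extend_coder (LQ L)) (s i v) x;
  rinv_eval : forall i (v : Lspace L i), evaluation (s i v) i = v }.

End Linfty.

(* Main.v *)
Require Import Defs.
From HB Require Import structures.
From Stdlib Require Import Relations.
From mathcomp Require Import all_boot all_algebra.
Import GRing.Theory.
Local Open Scope ring_scope.

Set Implicit Arguments.
Unset Strict Implicit.
Unset Printing Implicit Defensive.

(** Let [s] be the dg right inverse.  Think of an L-infinity[1] algebra as a formal
    manifold [V] with a homological vector field [Q] vanishing at the origin,
    and of [s v] as a vector field on it whose value at the origin is [v].  As
    [[Q, s v] = s (q_1 v)], the tautological vector field [(v, x) |-> s v] on
    [V * V] commutes with the sum of the linear field [q_1] on the first factor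
    and of [Q] on the second.  Its flow therefore commutes with that field.
    Since [Q] vanishes at the origin, the time-one flow of the points [(v, 0)]
    defines a formal map [v |-> exp (s v) 0] that carries [q_1] to [Q], and its
    linear part is the identity.  Hence [(V, Q)] is even isomorphic to the abelian
    [(V, q_1)].

    On the symmetric coalgebra the exponential is the symmetrized product
      [F (v_1 ... v_n) = 1/n! sum_sigma +- s v_sigma(1) (... (s v_sigma(n) 1))],
    which is where characteristic zero enters.  It is handled without
    permutations, through the recursion
      [n F (w) = sum_{w = (x, w')} +- s x (F w')]
    over the unshuffles that single out one letter ([exp_word_rec]).
    Multiplying by [n] turns both key identities into inductions on [n].
    - [F] is a coalgebra morphism ([comult_exp_word]): the [s x] are
      coderivations of the coproduct, so [n] times the coproduct of [F w] is a
      sum over unshuffles of [w] into a letter and two words [u], [v], with the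
      letter acting on either side.  Absorbing the letter into [u] gives [|u|]
      times, and into [v] gives [|v|] times, the expected term, and
      [|u| + |v| = n].  The regroupings are the coassociativity laws
      [unshuffle_sumA] and [unshuffle_sumCA].
    - [F] intertwines the linear coderivation with [Q] ([exp_word_commute]):
      commute [Q] past [s x] and use that Leibniz sums distribute over
      unshuffles ([leibniz_unshuffle_sum]), together with [Q 1 = 0].
    The coderivation with [q_1] as its only Taylor coefficient squares to zero
    because [s (q_1 (q_1 v)) = [Q, [Q, s v]] = 0], which evaluates to
    [q_1 (q_1 v) = 0] ([differential_sq]). *)

(** * Sums over unshuffles *)

Lemma linear_bundle (K : fieldType) (M N : lmodType K) (h : M -> N) :
  linear h -> exists hL : {linear M -> N}, h = hL.
Proof.
move=> h_lin.
by exists (HB.pack h (GRing.isLinear.Build K M N _ h h_lin) : {linear M -> N}).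
Qed.

Section UnshuffleSums.
Variables (K : fieldType) (V : int -> lmodType K).
Local Notation seqV := (seq (letter V)).

Lemma unshuffle_sum_nil (M : lmodType K) (b : seqV -> seqV -> M) :
  unshuffle_sum b [::] = b [::] [::].
Proof. by rewrite /unshuffle_sum big_seq1 scale1r. Qed.

Lemma wdeg_nil : wdeg ([::] : seqV) = 0.
Proof. exact: big_nil. Qed.

Lemma eq_in_unshuffle_sum (M : lmodType K) (b c : seqV -> seqV -> M) w :
  (forall u v, (size u + size v)%N = size w -> wdeg u + wdeg v = wdeg w ->
    b u v = c u v) ->
  unshuffle_sum b w = unshuffle_sum c w.
Proof.
elim: w b c => [|x w IH] b c bc.
  by rewrite !unshuffle_sum_nil bc // wdeg_nil addr0.
rewrite !unshuffle_sum_cons; congr (_ + _); apply: IH => u v szE degE.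
  by rewrite bc //= ?addSn ?szE // !wdeg_cons -degE addrA.
by rewrite bc //= ?addnS ?szE // !wdeg_cons -degE addrCA.
Qed.

Lemma unshuffle_sumD (M : lmodType K) (b c : seqV -> seqV -> M) w :
  unshuffle_sum (fun u v => b u v + c u v) w =
  unshuffle_sum b w + unshuffle_sum c w.
Proof.
by rewrite -[unshuffle_sum b w]scale1r -unshuffle_sumP; apply: eq_unshuffle_sum
  => u v; rewrite scale1r.
Qed.

Lemma unshuffle_sumZ (M : lmodType K) a (b : seqV -> seqV -> M) w :
  unshuffle_sum (fun u v => a *: b u v) w = a *: unshuffle_sum b w.
Proof.
by rewrite /unshuffle_sum scaler_sumr; apply: eq_bigr => t _; rewrite !scalerA mulrC.
Qed.

Lemma unshuffle_sum0 (M : lmodType K) (b : seqV -> seqV -> M) w :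
  (forall u v, (size u + size v)%N = size w -> b u v = 0) -> unshuffle_sum b w = 0.
Proof.
move=> b0; rewrite -[RHS](scale0r (unshuffle_sum b w)) -unshuffle_sumZ.
by apply: eq_in_unshuffle_sum => u v szE _; rewrite b0 // scaler0.
Qed.

Lemma linear_unshuffle_sum (M N : lmodType K) (h : M -> N)
    (b : seqV -> seqV -> M) w :
  linear h -> h (unshuffle_sum b w) = unshuffle_sum (fun u v => h (b u v)) w.
Proof.
case/linear_bundle=> hL ->; rewrite /unshuffle_sum linear_sum.
by apply: eq_bigr => t _; rewrite linearZ.
Qed.

Lemma unshuffle_sum_span (M : lmodType K) (P : M -> Prop)
    (b : seqV -> seqV -> M) w :
  (forall u v, wdeg u + wdeg v = wdeg w -> Defs.span P (b u v)) ->
  Defs.span P (unshuffle_sum b w).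
Proof.
elim: w b => [|x w IH] b Pb.
  rewrite unshuffle_sum_nil; apply: Pb.
  by rewrite wdeg_nil addr0.
rewrite unshuffle_sum_cons; apply: span_add; apply: IH => u v degE.
  by apply: Pb; rewrite !wdeg_cons -degE addrA.
by apply/span_scale/Pb; rewrite !wdeg_cons -degE addrCA.
Qed.

(** Coassociativity.  The Koszul sign of splitting off [a], then [b] from the
    rest, is that of splitting off both, then separating them. *)
Lemma unshuffle_sumA (M : lmodType K) (c : seqV -> seqV -> seqV -> M) w :
  unshuffle_sum (fun a w' => unshuffle_sum (c a) w') w =
  unshuffle_sum (fun u v => unshuffle_sum (fun a b => c a b v) u) w.
Proof.
elim: w c => [|x w IH] c; first by rewrite !unshuffle_sum_nil.
rewrite !unshuffle_sum_cons.
rewrite (IH (fun a => c (x :: a))).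
under [X in _ + X = _]eq_unshuffle_sum => a w' do
  rewrite unshuffle_sum_cons scalerDr -!unshuffle_sumZ.
under [X in _ = X + _]eq_unshuffle_sum => u v do rewrite unshuffle_sum_cons.
rewrite !unshuffle_sumD -addrA; congr (_ + (_ + _)); rewrite IH //.
apply: eq_unshuffle_sum => u v; rewrite -unshuffle_sumZ.
apply: eq_in_unshuffle_sum => a b _ degE.
by rewrite scalerA -sgnD -mulrDr degE.
Qed.

(** Coassociativity combined with cocommutativity: the explicit sign is the one
    of moving [a] past [u], so that [u] may be split off first. *)
Lemma unshuffle_sumCA (M : lmodType K) (c : seqV -> seqV -> seqV -> M) w :
  unshuffle_sum (fun a w' => unshuffle_sum
    (fun u v => (-1) ^ (wdeg a * wdeg u) *: c a u v) w') w =
  unshuffle_sum (fun u w' => unshuffle_sum (fun a v => c a u v) w') w.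
Proof.
elim: w c => [|x w IH] c.
  by rewrite !unshuffle_sum_nil wdeg_nil mulr0 scale1r.
rewrite !unshuffle_sum_cons.
under [X in _ + X = _]eq_unshuffle_sum => a w' do
  rewrite unshuffle_sum_cons scalerDr -!unshuffle_sumZ.
under [X in _ = _ + X]eq_unshuffle_sum => a w' do
  rewrite unshuffle_sum_cons scalerDr -!unshuffle_sumZ.
rewrite !unshuffle_sumD addrCA; congr (_ + (_ + _)); rewrite -[RHS]IH.
- apply: eq_unshuffle_sum => a w'; apply: eq_unshuffle_sum => u v.
  by rewrite !scalerA wdeg_cons mulrDr sgnD mulrA [wdeg a * tag x]mulrC sgnK mul1r.
- apply: eq_unshuffle_sum => a w'; apply: eq_unshuffle_sum => u v.
  by rewrite !scalerA wdeg_cons mulrDl sgnD mulrC.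
- apply: eq_unshuffle_sum => a w'; apply: eq_unshuffle_sum => u v.
  by rewrite !scalerA mulrC [_ ^ (tag x * wdeg u) * _]mulrC.
Qed.

End UnshuffleSums.

(** * Leibniz sums *)

Section LeibnizSums.
Variables (K : fieldType) (V : int -> lmodType K).
Variable d : forall i, V i -> V (i + 1).
Hypothesis d_lin : forall i, linear (@d i).
Local Notation seqV := (seq (letter V)).

Definition dletter (x : letter V) : letter V := Tagged V (d (tagged x)).

(** For [f] the monomial map this is the coderivation extending [d]; keeping [f]
    arbitrary lets the same sum act on words, on each leg of a coproduct and
    through any linear map. *)
Fixpoint leibniz_sum (M : lmodType K) (f : seqV -> M) (w : seqV) : M :=
  if w is x :: w' then
    f (dletter x :: w') + (-1) ^ tag x *: leibniz_sum (fun v => f (x :: v)) w'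
  else 0.

Lemma wdeg_dletter x (w : seqV) : wdeg (dletter x :: w) = wdeg (x :: w) + 1.
Proof. by rewrite !wdeg_cons addrAC. Qed.

Lemma eq_leibniz_sum (M : lmodType K) (f g : seqV -> M) w :
  (forall w', size w' = size w -> wdeg w' = wdeg w + 1 -> f w' = g w') ->
  leibniz_sum f w = leibniz_sum g w.
Proof.
elim: w f g => //= x w IH f g fg; congr (_ + _ *: _).
  by apply: fg => //; apply: wdeg_dletter.
by apply: IH => w' szE degE; apply: fg; rewrite /= ?szE // !wdeg_cons degE addrA.
Qed.

Lemma leibniz_sumP (M : lmodType K) a (f g : seqV -> M) w :
  leibniz_sum (fun v => a *: f v + g v) w =
  a *: leibniz_sum f w + leibniz_sum g w.
Proof.
elim: w f g => [|x w IH] f g /=; first by rewrite scaler0 addr0.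
by rewrite IH !scalerDr !scalerA [a * _]mulrC addrACA.
Qed.

Lemma leibniz_sumZ (M : lmodType K) a (f : seqV -> M) w :
  leibniz_sum (fun v => a *: f v) w = a *: leibniz_sum f w.
Proof.
elim: w f => [|x w IH] f /=; first by rewrite scaler0.
by rewrite IH !scalerDr !scalerA [a * _]mulrC.
Qed.

Lemma leibniz_sumD (M : lmodType K) (f g : seqV -> M) w :
  leibniz_sum (fun v => f v + g v) w = leibniz_sum f w + leibniz_sum g w.
Proof.
elim: w f g => [|x w IH] f g /=; first by rewrite addr0.
by rewrite IH !scalerDr addrACA.
Qed.

Lemma leibniz_sum0 (M : lmodType K) (f : seqV -> M) w :
  (forall v, size v = size w -> f v = 0) -> leibniz_sum f w = 0.
Proof.
move=> f0; rewrite -(scale0r (leibniz_sum f w)) -leibniz_sumZ.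
by apply: eq_leibniz_sum => v szE _; rewrite f0 // scaler0.
Qed.

Lemma linear_leibniz_sum (M N : lmodType K) (h : M -> N) (f : seqV -> M) w :
  linear h -> h (leibniz_sum f w) = leibniz_sum (fun v => h (f v)) w.
Proof.
case/linear_bundle=> hL ->.
elim: w f => [|x w IH] f /=; first by rewrite linear0.
by rewrite linearD linearZ /= IH.
Qed.

Lemma leibniz_sum_span (M : lmodType K) (P : M -> Prop) (f : seqV -> M) w :
  (forall v, wdeg v = wdeg w + 1 -> Defs.span P (f v)) -> Defs.span P (leibniz_sum f w).
Proof.
elim: w f => [|x w IH] f Pf /=; first exact: span0.
apply: span_add; first by apply: Pf; apply: wdeg_dletter.
by apply/span_scale/IH => v degE; apply: Pf; rewrite !wdeg_cons degE addrA.
Qed.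

Lemma leibniz_sum_smul (M : lmodType K) (f : seqV -> M) :
  symmetric_multilinear f -> symmetric_multilinear (leibniz_sum f).
Proof.
move=> f_smul.
have tail_smul z g : symmetric_multilinear g ->
    symmetric_multilinear (fun v => g (z :: v) : M).
  move=> gs; split=> [u w i a x y|u w x y].
    exact: (smul_lin gs (z :: u)).
  exact: (smul_sym gs (z :: u)).
split=> [u w i a x y|u w x y]; elim: u f f_smul => [|z u IH] f fs /=.
- rewrite /dletter /= d_lin (smul_lin fs [::]) /= scalerDr addrACA.
  congr (_ + _); rewrite scalerA mulrC -scalerA -scalerDr -leibniz_sumP.
  by congr (_ *: _); apply: eq_leibniz_sum => v _ _; apply: (smul_lin fs [::]).
- rewrite (smul_lin fs (dletter z :: u)) IH; last exact: tail_smul.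
  by rewrite !scalerDr addrACA !scalerA [_ * a]mulrC.
- rewrite (smul_sym fs [::] _ (dletter x)) (smul_sym fs [::] _ x).
  under eq_leibniz_sum => v _ _ do rewrite (smul_sym fs [::]) /=.
  rewrite leibniz_sumZ !scalerDr !scalerA /=; set p := leibniz_sum _ _.
  rewrite addrCA; congr (_ + (_ + _)); congr (_ *: _).
    by rewrite mulrDr mulr1 sgnD mulrCA sgnK mulr1.
    by rewrite mulrDl mul1r sgnD.
  by rewrite mulrC [_ ^ tag x * _]mulrC mulrA.
- rewrite (smul_sym fs (dletter z :: u)) IH; last exact: tail_smul.
  by rewrite scalerDr !scalerA [_ ^ tag z * _]mulrC.
Qed.

(** The terms in which the two copies of [d] hit different letters cancel in
    pairs, as [d] is odd. *)
Lemma leibniz_sum_sq (M : lmodType K) (f : seqV -> M) w :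
  (forall i (v : V i), d (d v) = 0) ->
  symmetric_multilinear f -> leibniz_sum (leibniz_sum f) w = 0.
Proof.
move=> d_sq; elim: w f => //= x w IH f fs.
have f0 i u : f (Tagged V (0 : V i) :: u) = 0.
  have := smul_lin fs [::] u 1 (0 : V i) 0.
  rewrite /= !scale1r addr0 => /eqP.
  by rewrite -subr_eq0 opprD addrA subrr add0r oppr_eq0 => /eqP.
have ddx : f (dletter (dletter x) :: w) = 0 by rewrite /dletter /= d_sq f0.
rewrite ddx add0r leibniz_sumD leibniz_sumZ IH; last first.
  split=> [u v i a y z|u v y z].
    exact: (smul_lin fs (x :: u)).
  exact: (smul_sym fs (x :: u)).
rewrite scaler0 addr0 -scalerDl.
have -> : (-1) ^ tag (dletter x) = - (-1) ^ tag x :> K by rewrite sgnD mulrN1.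
by rewrite addNr scale0r.
Qed.

(** Stated for an arbitrary [b], this gives both the coderivation property of the
    extension of [d] and the compatibility of the exponential with [d]. *)
Lemma leibniz_unshuffle_sum (M : lmodType K) (b : seqV -> seqV -> M) w :
  leibniz_sum (unshuffle_sum b) w = unshuffle_sum (fun u v =>
    leibniz_sum (b^~ v) u + (-1) ^ wdeg u *: leibniz_sum (b u) v) w.
Proof.
elim: w b => [|x w IH] b.
  by rewrite unshuffle_sum_nil /= scaler0 addr0.
rewrite /= !unshuffle_sum_cons.
under eq_leibniz_sum => v _ _ do rewrite unshuffle_sum_cons.
rewrite leibniz_sumD !IH scalerDr -!unshuffle_sumZ addrACA.
congr (_ + _); rewrite -unshuffle_sumD; apply: eq_unshuffle_sum => u v /=.
  by rewrite wdeg_cons sgnD scalerDr scalerA addrA.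
rewrite leibniz_sumZ.
under eq_leibniz_sum => v' _ degE do rewrite degE.
rewrite leibniz_sumZ mulrDl mul1r mulrDr mulr1 !sgnD !scalerDr !scalerA.
rewrite addrCA; congr (_ + (_ + _)); congr (_ *: _).
  by rewrite mulrCA sgnK mulr1.
by rewrite mulrC [_ ^ tag x * _]mulrC mulrA.
Qed.

End LeibnizSums.

(** * Linear maps on symmetric coalgebras *)

Lemma tens0l (K : fieldType) (A B : lmodType K) (y : B) : tens (0 : A) y = 0.
Proof. by rewrite -[X in tens X _](scale0r (0 : A)) tensZl scale0r. Qed.

Lemma tens0r (K : fieldType) (A B : lmodType K) (x : A) : tens x (0 : B) = 0.
Proof. by rewrite -[X in tens _ X](scale0r (0 : B)) tensZr scale0r. Qed.

Section SymmetricLinear.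
Variables (K : fieldType) (V : int -> lmodType K).
Local Notation seqV := (seq (letter V)).

Lemma sym_ext m (M : lmodType K) (g h : {linear sym V m -> M}) :
  (forall w, (m <= size w)%N -> g (mono m w) = h (mono m w)) ->
  forall x, g x = h x.
Proof.
move=> gh; apply: symW => [|a w x le_mw IH]; first by rewrite !linear0.
by rewrite !linearP gh // IH.
Qed.

Lemma has_degree_mono (W : int -> lmodType K) m (d : int)
    (F : {linear sym V m -> sym W m}) :
  (forall w, sym_homogeneous (wdeg w + d) (F (mono m w))) -> has_degree d F.
Proof.
move=> Fw k x; elim=> [|a _ y [w <- ->] _ IH]; first by rewrite linear0; apply: span0.
by rewrite linearP; apply: span_add IH; apply/span_scale/Fw.
Qed.

Lemma mono_homogeneous m (w : seqV) : sym_homogeneous (wdeg w) (mono m w).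
Proof.
rewrite /sym_homogeneous -[mono m w]addr0 -[mono m w]scale1r.
by apply: spanD; [exists w | apply: span0].
Qed.

Lemma koszul_homogeneous m (d k : int) (x : sym V m) :
  sym_homogeneous k x -> koszul V m d x = (-1) ^ (d * k) *: x.
Proof.
elim=> [|a _ y [w <- ->] _ IH]; first by rewrite linear0 scaler0.
rewrite linearP /= IH scalerDr !scalerA [_ * a]mulrC -scalerA.
congr (a *: _ + _).
by have [/koszulE-> //|/mono_short->] := leqP m (size w); rewrite linear0 scaler0.
Qed.

Lemma linear_smul (M N : lmodType K) (h : M -> N) (f : seqV -> M) :
  linear h -> symmetric_multilinear f -> symmetric_multilinear (fun w => h (f w)).
Proof.
case/linear_bundle=> hL -> fs; split=> [u w i a x y|u w x y].
  by rewrite (smul_lin fs) linearP.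
by rewrite (smul_sym fs) linearZ.
Qed.

Lemma comult_mono m w : (m <= size w)%N ->
  comult V m (mono m w) = unshuffle_sum (fun u v => tens (mono m u) (mono m v)) w.
Proof. exact: comultE. Qed.

Lemma tensor_map_unshuffle (A B A' B' : lmodType K) (f : {linear A -> A'})
    (g : {linear B -> B'}) (b : seqV -> A) (c : seqV -> B) w :
  tensor_map f g (unshuffle_sum (fun u v => tens (b u) (c v)) w) =
  unshuffle_sum (fun u v => tens (f (b u)) (g (c v))) w.
Proof.
rewrite (linear_unshuffle_sum _ _ (linearP _)).
by apply: eq_unshuffle_sum => u v; rewrite tensor_mapE.
Qed.

(** Killing short words sends the monomial of a word shorter than [m'] to [0],
    which is also what [mono m'] returns on it. *)
Lemma resizeEw m m' (w : seqV) : (m <= m')%N -> resize V m m' (mono m w) = mono m' w.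
Proof.
move=> le_mm'; have [/resizeE-> //|lt_wm] := leqP m (size w).
by rewrite !mono_short ?linear0 // (leq_trans lt_wm).
Qed.

Lemma resize_retract m m' (x : sym V m') : (m <= m')%N ->
  resize V m m' (resize V m' m x) = x.
Proof.
move=> le_mm'; have := @sym_ext m' _ (resize V m m' \o resize V m' m) idfun.
by apply=> w le_m'w; rewrite /= resizeE // resizeEw.
Qed.

(** Killing short words is a coalgebra morphism, since an unshuffle of a word
    with fewer than [m'] letters has parts with fewer than [m'] letters. *)
Lemma comult_resize m m' (x : sym V m) : (m <= m')%N ->
  comult V m' (resize V m m' x) =
  tensor_map (resize V m m') (resize V m m') (comult V m x).
Proof.
move=> le_mm'; have := @sym_ext m _ (comult V m' \o resize V m m')
  (tensor_map (resize V m m') (resize V m m') \o comult V m).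
apply=> w le_mw; rewrite /= comult_mono // tensor_map_unshuffle resizeE //.
have [le_m'w|lt_wm'] := leqP m' (size w).
  rewrite comult_mono //; apply: eq_unshuffle_sum => u v.
  by rewrite !resizeEw.
rewrite mono_short // linear0; apply/esym.
apply: unshuffle_sum0 => u v szE; rewrite resizeEw // mono_short; last first.
  by rewrite (leq_ltn_trans _ lt_wm') // -szE leq_addr.
exact: tens0l.
Qed.

End SymmetricLinear.

(** * The coderivation with a given linear Taylor coefficient *)

Section LinearCoderivation.
Variables (K : fieldType) (V : int -> lmodType K) (m : nat).
Variable d : forall i, V i -> V (i + 1).
Hypothesis d_lin : forall i, linear (@d i).

Definition linear_coder : {linear sym V m -> sym V m} :=
  sym_lift m (leibniz_sum_smul d_lin (mono_smul V m)).

Lemma linear_coderE w : linear_coder (mono m w) = leibniz_sum d (mono m) w.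
Proof.
have [/sym_liftE-> //|lt_wm] := leqP m (size w); rewrite mono_short // linear0.
by rewrite leibniz_sum0 // => v szE; rewrite mono_short ?szE.
Qed.

Lemma linear_coder_coderivation : coderivation 1 linear_coder.
Proof.
split=> [|x].
  apply: has_degree_mono => w; rewrite linear_coderE.
  by apply: leibniz_sum_span => v <-; apply: mono_homogeneous.
have := @sym_ext _ _ m _ (comult V m \o linear_coder)
  ((tensor_map linear_coder idfun \o comult V m) \+
   (tensor_map (koszul V m 1) linear_coder \o comult V m)).
apply=> w le_mw.
change (comult V m (linear_coder (mono m w)) =
  tensor_map linear_coder idfun (comult V m (mono m w)) +
  tensor_map (koszul V m 1) linear_coder (comult V m (mono m w))).
rewrite linear_coderE (linear_leibniz_sum _ _ _ (linearP _)).
under eq_leibniz_sum => v szE _ do rewrite comult_mono ?szE //.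
rewrite [leibniz_sum _ _ _]leibniz_unshuffle_sum unshuffle_sumD.
rewrite comult_mono // !tensor_map_unshuffle.
congr (_ + _); apply: eq_unshuffle_sum => u v; rewrite linear_coderE.
  by rewrite (linear_leibniz_sum _ _ _ (tens_linl _)).
rewrite (koszul_homogeneous _ (mono_homogeneous _ _)) mul1r tensZl.
by rewrite (linear_leibniz_sum _ _ _ (tens_linr _)).
Qed.

Lemma linear_coder_sq : (forall i (v : V i), d (d v) = 0) ->
  forall x, linear_coder (linear_coder x) = 0.
Proof.
move=> d_sq x; have := @sym_ext _ _ m _ (linear_coder \o linear_coder) \0.
apply=> w le_mw /=; rewrite linear_coderE (linear_leibniz_sum _ _ _ (linearP _)).
under eq_leibniz_sum => v _ _ do rewrite linear_coderE.
exact: leibniz_sum_sq d_sq (mono_smul _ _).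
Qed.

Lemma taylor_linear_coder j w : (m <= size w)%N ->
  taylor linear_coder j w = leibniz_sum d (single j) w.
Proof.
move=> le_mw; rewrite /taylor linear_coderE (linear_leibniz_sum _ _ _ (linearP _)).
by apply: eq_leibniz_sum => v szE _; rewrite projE // szE.
Qed.

Lemma taylor_linear_coder_long j w : (m <= size w)%N -> (1 < size w)%N ->
  taylor linear_coder j w = 0.
Proof.
move=> le_mw lt_1w; rewrite taylor_linear_coder //.
by apply: leibniz_sum0 => -[|x [|y v]] // szE; move: lt_1w; rewrite -szE.
Qed.

End LinearCoderivation.

(** * The exponential of a family of coderivations *)

Section Exponential.
Variables (K : fieldType) (char0 : [pchar K] =i pred0).
Variables (V : int -> lmodType K).
Variable s : forall i, V i -> {linear sym V 0 -> sym V 0}.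
Hypothesis s_lin : forall i a (u v : V i) x, s (a *: u + v) x = a *: s u x + s v x.
Hypothesis s_coder : forall i (v : V i), coderivation i (s v).
Local Notation seqV := (seq (letter V)).

Lemma succn_neq0 n : n.+1%:R != 0 :> K.
Proof. by have /pcharf0P -> := char0. Qed.

(** The linear map from words to operators with [s] as its only component, in
    word length one; the exponential is that of the convolution product on such
    maps. *)
Definition letter_action (u : seqV) (y : sym V 0) : sym V 0 :=
  if u is [:: x] then s (tagged x) y else 0.

Lemma letter_action_smul y : symmetric_multilinear (letter_action^~ y).
Proof.
split=> [[|z [|z' u]] [|z'' w] i a x x'|[|z [|z' u]] w x x'] /=;
  by rewrite ?scaler0 ?addr0 // s_lin.
Qed.

Lemma letter_action_linear u : linear (letter_action u).
Proof.
by case: u => [|x [|z u]] a y y' /=; rewrite ?scaler0 ?addr0 // linearP.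
Qed.

(** The [n]-th divided convolution power of [letter_action], applied to the unit
    of the coalgebra.  It is supported on words of length [n]; separating [n]
    from the word keeps it symmetric and multilinear, and makes the recursion
    structural. *)
Fixpoint exp_coef (n : nat) (w : seqV) : sym V 0 :=
  if n is n'.+1 then
    n%:R^-1 *: unshuffle_sum (fun u v => letter_action u (exp_coef n' v)) w
  else if w is [::] then mono 0 [::] else 0.

Definition exp_word (w : seqV) : sym V 0 := exp_coef (size w) w.

Lemma exp_coef_smul n : symmetric_multilinear (exp_coef n).
Proof.
elim: n => [|n IH]; first by split=> [[|z u]|[|z u]] * /=; rewrite ?scaler0 ?addr0.
apply: linear_smul => [a x y|]; first by rewrite scalerDr !scalerA mulrC.
apply: unshuffle_sum_smul => [v|u]; first exact: letter_action_smul.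
exact/linear_smul/IH/letter_action_linear.
Qed.

Lemma exp_word_smul : symmetric_multilinear exp_word.
Proof.
split=> [u w i a x y|u w x y]; rewrite /exp_word !size_cat /=.
  exact: (smul_lin (exp_coef_smul _)).
exact: (smul_sym (exp_coef_smul _)).
Qed.

Lemma exp_coef_homogeneous n w : sym_homogeneous (wdeg w) (exp_coef n w).
Proof.
elim: n w => [|n IH] w /=.
  by case: w => [|x w]; [apply: mono_homogeneous | apply: span0].
apply: span_scale; apply: unshuffle_sum_span => -[|x [|y u]] v degE;
  try exact: span0.
have [deg_s _] := s_coder (tagged x).
by rewrite -degE [wdeg [:: x]]big_seq1 addrC; apply/deg_s/IH.
Qed.

(** The Euler identity for the exponential: its derivative along scaling is the
    product with [s]. *)
Lemma exp_word_rec w : (size w)%:R *: exp_word w =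
  unshuffle_sum (fun u v => letter_action u (exp_word v)) w.
Proof.
case: w => [|x w]; first by rewrite scale0r unshuffle_sum_nil.
rewrite {1}/exp_word /= scalerA divff ?succn_neq0 // scale1r.
apply: eq_in_unshuffle_sum => -[|y [|z u]] v //= [szE] _.
by rewrite /exp_word -szE.
Qed.

Lemma exp_word1 i (v : V i) : exp_word [:: Tagged V v] = s v (mono 0 [::]).
Proof.
have := exp_word_rec [:: Tagged V v].
rewrite scale1r => ->; rewrite unshuffle_sum_cons !unshuffle_sum_nil /=.
by rewrite scaler0 addr0.
Qed.

(** The exponential of a primitive element is group-like. *)
Lemma comult_exp_word w : comult V 0 (exp_word w) =
  unshuffle_sum (fun u v => tens (exp_word u) (exp_word v)) w.
Proof.
have [n] := ubnP (size w); elim: n w => // n IH w.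
case: w => [|x w'] szw; first by rewrite /exp_word comult_mono // !unshuffle_sum_nil.
set w := x :: w' in szw *.
apply: (scalerI (succn_neq0 (size w'))).
rewrite -[(size w').+1]/(size w) -linearZ exp_word_rec.
rewrite (linear_unshuffle_sum _ _ (linearP _)).
pose l := letter_action; pose e := exp_word.
(* Only one-letter words [a] act, and then [l a] is a coderivation. *)
transitivity (unshuffle_sum (fun a v => unshuffle_sum (fun u u' =>
    tens (l a (e u)) (e u') +
    (-1) ^ (wdeg a * wdeg u) *: tens (e u) (l a (e u'))) v) w).
  apply: eq_in_unshuffle_sum => a v szE _.
  case: a szE => [|y [|z a]] szE; rewrite /l /=;
    try by rewrite linear0 unshuffle_sum0 // => u u' _;
      rewrite tens0l tens0r scaler0 addr0.
  have [_ ->] := s_coder (tagged y).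
  rewrite IH; last by case: szE szw => /= <-; rewrite add0n ltnS.
  rewrite !tensor_map_unshuffle -unshuffle_sumD; apply: eq_unshuffle_sum => u u'.
  rewrite (koszul_homogeneous _ (exp_coef_homogeneous _ _)) tensZl.
  by rewrite [wdeg [:: y]]big_seq1.
under eq_unshuffle_sum => a v do rewrite unshuffle_sumD.
(* Regroup so that [a] is absorbed into the leg of the coproduct it acts on. *)
rewrite unshuffle_sumD unshuffle_sumCA unshuffle_sumA -unshuffle_sumD -unshuffle_sumZ.
apply: eq_in_unshuffle_sum => u v szE _.
rewrite -(linear_unshuffle_sum _ _ (tens_linl (e v))).
rewrite -(linear_unshuffle_sum _ _ (tens_linr (e u))) -!exp_word_rec.
by rewrite tensZl tensZr -scalerDl -natrD szE.
Qed.

(** Moving [Q] past [s x] replaces [x] by [d x] and leaves the sign of a Leibniz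
    sum; the copy of [Q] that passes all letters meets the unit, which it kills. *)
Lemma exp_word_commute (d : forall i, V i -> V (i + 1))
    (Q : {linear sym V 0 -> sym V 0}) :
  Q (mono 0 [::]) = 0 ->
  (forall i (v : V i) y, Q (s v y) = s (d i v) y + (-1) ^ i *: s v (Q y)) ->
  forall w, Q (exp_word w) = leibniz_sum d exp_word w.
Proof.
move=> Q1 Qs w; have [n] := ubnP (size w); elim: n w => // n IH w.
case: w => [|x w'] szw; first by rewrite /exp_word.
set w := x :: w' in szw *.
apply: (scalerI (succn_neq0 (size w'))).
rewrite -[(size w').+1]/(size w) -leibniz_sumZ.
under [RHS]eq_leibniz_sum => v szE _ do rewrite -szE exp_word_rec.
rewrite [RHS]leibniz_unshuffle_sum -linearZ exp_word_rec.
rewrite (linear_unshuffle_sum _ _ (linearP _)).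
apply: eq_in_unshuffle_sum => -[|y [|z u]] v szE _.
- by rewrite /= linear0 add0r leibniz_sum0 ?scaler0.
- rewrite /= Qs IH; last by case: szE szw => /= <-; rewrite add0n ltnS.
  rewrite scaler0 addr0 [wdeg [:: y]]big_seq1.
  by rewrite (linear_leibniz_sum _ _ _ (linearP _)).
- rewrite linear0 [X in _ *: X]leibniz_sum0 // scaler0 addr0.
  by rewrite leibniz_sum0 // => -[|y' [|z' u']].
Qed.

(** The exponential, restricted to positive word lengths and projected there; the
    unit goes to the unit, so neither step loses information. *)
Definition exp_map : {linear sym V 1 -> sym V 1} :=
  sym_lift 1 (linear_smul (linearP (resize V 0 1)) exp_word_smul).

Lemma exp_mapE w : exp_map (mono 1 w) = resize V 0 1 (exp_word w).
Proof.
case: w => [|x w]; last by rewrite sym_liftE.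
by rewrite /exp_word /= resizeEw // mono_short // linear0.
Qed.

Lemma exp_map_degree : has_degree 0 exp_map.
Proof.
apply: has_degree_mono => w; rewrite addr0 exp_mapE.
have : sym_homogeneous (wdeg w) (exp_word w) by apply: exp_coef_homogeneous.
elim=> [|a _ y [v <- ->] _ IH]; first by rewrite linear0; apply: span0.
rewrite linearP resizeEw //.
by apply: span_add IH; apply/span_scale/mono_homogeneous.
Qed.

Lemma exp_map_comult x :
  comult V 1 (exp_map x) = tensor_map exp_map exp_map (comult V 1 x).
Proof.
have := @sym_ext _ _ 1 _ (comult V 1 \o exp_map)
  (tensor_map exp_map exp_map \o comult V 1).
apply=> w le_1w.
change (comult V 1 (exp_map (mono 1 w)) =
  tensor_map exp_map exp_map (comult V 1 (mono 1 w))).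
rewrite exp_mapE comult_resize // comult_exp_word comult_mono //.
rewrite !tensor_map_unshuffle.
by apply: eq_unshuffle_sum => u v; rewrite !exp_mapE.
Qed.

Lemma exp_map_commute (d : forall i, V i -> V (i + 1))
    (d_lin : forall i, linear (@d i)) (Q : {linear sym V 1 -> sym V 1}) :
  (forall i (v : V i) y,
    s (d i v) y = commutator 1 i (extend_coder Q) (s v) y) ->
  forall x, exp_map (linear_coder 1 d_lin x) = Q (exp_map x).
Proof.
move=> Qs x.
have := @sym_ext _ _ 1 _ (exp_map \o linear_coder 1 d_lin) (Q \o exp_map).
apply=> w le_1w; rewrite /= linear_coderE (linear_leibniz_sum _ _ _ (linearP _)).
under eq_leibniz_sum => v _ _ do rewrite exp_mapE.
rewrite -(linear_leibniz_sum _ _ _ (linearP _)) exp_mapE.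
rewrite -(exp_word_commute (Q := extend_coder Q)) /=.
- by rewrite resize_retract.
- by rewrite resizeEw // mono_short // !linear0.
- by move=> i v y; rewrite Qs /commutator mul1r subrK.
Qed.

Lemma exp_map_linear_part i (v : V i) :
  taylor exp_map i [:: Tagged V v] = evaluation (s v) i.
Proof.
rewrite /evaluation /taylor exp_mapE exp_word1.
have := @sym_ext _ _ 0 _ (proj V 1 i \o resize V 0 1) (proj V 0 i).
apply=> w _; rewrite /= resizeEw // [RHS]projE //.
case: w => [|x w]; last by rewrite projE.
by rewrite mono_short // linear0.
Qed.

End Exponential.

(** * The abelian structure and the isomorphism *)

Section Abelianization.
Variables (K : fieldType) (L : Linfty K).
Local Notation V := (Lspace L).

Definition differential i (v : V i) : V (i + 1) := q1 (i + 1) v.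

Lemma q1_linear i j : linear (q1 (L := L) (i := i) j).
Proof.
move=> a u v; rewrite /q1 /taylor.
by rewrite (smul_lin (mono_smul V 1) [::] [::]) !linearP.
Qed.

(** [q_1] squares to zero because [[Q, -]] does and [s] is injective, having
    evaluation as a left inverse. *)
Lemma differential_sq s : dg_right_inverse (L := L) s ->
  forall i (v : V i), differential (differential v) = 0.
Proof.
move=> s_inv i v; rewrite -[LHS](rinv_eval s_inv) /evaluation /taylor.
rewrite (rinv_dg s_inv) /commutator !(rinv_dg s_inv) /commutator.
set Q := extend_coder (LQ L); set x := mono 0 [::].
have QQ y : Q (Q y) = 0 by rewrite /Q /= resize_retract // LQ_square linear0.
clearbody Q; rewrite (_ : Q _ - _ = 0) ?linear0 //.
rewrite (linearB Q) (linearZ_LR Q) /= !QQ linear0 scaler0 subr0 sub0r !mul1r sgnD.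
by rewrite mulrN1 scaleNr opprK addNr.
Qed.

Definition abelianization s (s_inv : dg_right_inverse (L := L) s) : Linfty K :=
  {| Lspace := V;
     LQ := linear_coder 1 (fun i => q1_linear (i + 1));
     LQ_coder := linear_coder_coderivation 1 _;
     LQ_square := linear_coder_sq _ (differential_sq s_inv) |}.

Lemma abelianization_abelian s (s_inv : dg_right_inverse (L := L) s) :
  abelian_Linfty (abelianization s_inv).
Proof. by move=> w j sz_w; apply: taylor_linear_coder_long; rewrite // ltnW. Qed.

(** The degree equation is kept as a hypothesis because coboundaries use
    [i = (i - 1) + 1], which does not hold by computation. *)
Lemma abelianization_q1 s (s_inv : dg_right_inverse (L := L) s) i j (v : V i) :
  j = i + 1 -> q1 (L := abelianization s_inv) j v = q1 j v.
Proof.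
move=> ->; rewrite /q1 taylor_linear_coder //= scaler0 addr0.
by rewrite /dletter /= untagE ?etaggedE.
Qed.

End Abelianization.

Theorem proposition6p4 (K : fieldType) (char0 : [pchar K] =i pred0)
  (L : Linfty K) :
  (exists s, dg_right_inverse (L := L) s) -> homotopy_abelian L.
Proof.
case=> s s_inv; exists (abelianization s_inv); first exact: abelianization_abelian.
pose F := exp_map (rinv_linear s_inv).
apply/rst_sym/rst_step; exists F; split.
  split.
  - exact/exp_map_degree/(rinv_coder s_inv).
  - exact/exp_map_comult/(rinv_coder s_inv).
  - by apply: exp_map_commute => // i v y; apply: (rinv_dg s_inv).
have F1 i (v : Lspace L i) : linear_part (L := abelianization s_inv) F v = v.
  by rewrite /linear_part exp_map_linear_part // (rinv_eval s_inv).
have cocycleE i (v : Lspace L i) :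
    cocycle (L := abelianization s_inv) v <-> cocycle v.
  by rewrite /cocycle abelianization_q1.
have coboundaryE i (v : Lspace L i) :
    coboundary (L := abelianization s_inv) v <-> coboundary v.
  by split=> -[u ->]; exists u; rewrite abelianization_q1 ?subrK.
move=> i; split=> [v _|w w_cocycle].
  by rewrite F1 => /coboundaryE.
exists w; first exact/cocycleE.
rewrite F1 subrr; exists 0.
by have [h ->] := linear_bundle (@q1_linear _ L (i - 1) i); rewrite linear0.
Qed.
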